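(* Let $n\ge2$ and let $G=SL_n$ or $G=GL_n$. Given $M\in G(L)$, the element $x\in\widetilde W$ such that $M\in IxI$ is uniquely determined by the valuations of the determinants of all minors of $M$. That is: if $M,M'\in G(L)$ are such that for every $1\le m\le n$ and all subsets $R,C\subset\{1,\dots,n\}$ of size $m$ the determinants of the $m\times m$ submatrices of $M$ and of $M'$ with rows $R$ and columns $C$ have the same valuation, and if $M\in IxI$ and $M'\in Ix'I$ with $x,x'\in\widetilde W$, then $x=x'$.
   Context: Let $\bar k$ be an algebraic closure of a finite field, $L=\bar k((\epsilon))$ with valuation $\mathrm{val}$ ($\mathrm{val}(\epsilon)=1$, $\mathrm{val}(0)=\infty$), and $\mathfrak{o}_L=\bar k[[\epsilon]]$. $A\subset G$ is the diagonal torus, $W$ its Weyl group (the permutation group on $n$ letters), and $\widetilde W=W\ltimes X_*(A)$ is the extended affine Weyl group, whose elements are identified with monomial matrices whose nonzero entries are powers of $\epsilon$ (for $SL_n$, with exponents summing to $0$; when such a matrix has determinant $-1$, one changes the sign of an entry to get a representative in $SL_n(L)$, which does not affect double cosets). $I\subset G(L)$ is the Iwahori subgroup of matrices in $G(L)$ with entries in $\mathfrak{o}_L$, diagonal entries in $\mathfrak{o}_L^\times$, and entries below the diagonal in $\epsilon\mathfrak{o}_L$. By the Bruhat decomposition, $G(L)$ is the disjoint union of the double cosets $IxI$, $x\in\widetilde W$. ''Minors'' here are square submatrices, including $1\times1$ ones. *)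

(* Defs.v *)
From HB Require Import structures.
From mathcomp Require Import all_boot all_order all_fingroup all_algebra all_field.
From mathcomp Require Import boolp classical_sets fsbigop constructive_ereal.
From mathcomp Require Import zify.

Set Implicit Arguments.
Unset Strict Implicit.
Unset Printing Implicit Defensive.

Import Order.TTheory GRing.Theory Num.Theory.

Local Open Scope ring_scope.

Section LaurentSeries.
Variable k : fieldType.

Implicit Types (u v w : int -> k) (a b c m i : int).

Definition vanishes_below u a := forall i, i < a -> u i = 0.

Record laurent := Laurent {
  lcoef :> int -> k;
  lcoef_bounded : exists a, vanishes_below lcoef a }.

Lemma laurentP (f g : laurent) : (forall i, f i = g i) -> f = g.
Proof.
case: f g => [u hu] [v hv] /= /funext uv; subst v.
by rewrite (Prop_irrelevance hu hv).
Qed.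

HB.instance Definition _ := gen_eqMixin laurent.
HB.instance Definition _ := gen_choiceMixin laurent.

(* The sum has finite support as soon as u and v vanish below some index. *)
Definition conv u v m : k := \sum_(i \in [set: int]) u i * v (m - i).

Lemma vanishes_belowW u a b : b <= a -> vanishes_below u a -> vanishes_below u b.
Proof. by move=> ba ua i ib; apply: ua; apply: lt_le_trans ba. Qed.

Lemma convE u v a b : vanishes_below u a -> vanishes_below v b ->
  forall m (N : nat), m - a - b < N%:Z ->
  conv u v m = \sum_(j < N) u (a + j%:Z) * v (m - a - j%:Z).
Proof.
move=> ua vb m N mN; rewrite /conv.
rewrite (fsbigE [seq a + j%:Z | j <- iota 0 N]) //=.
- rewrite big_map /= -{1}[N]subn0 big_mkord.
  by apply: eq_big => [j|j _]; rewrite ?in_setT // opprD addrA.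
- rewrite map_inj_uniq ?iota_uniq // => i j /addrI.
  by case.
- move=> i _; apply: contraNeq => nz0; apply/mapP.
  have ai : a <= i.
    by rewrite leNgt; apply/negP => /ua ui; rewrite ui mul0r eqxx in nz0.
  have bi : b <= m - i.
    by rewrite leNgt; apply/negP => /vb vi; rewrite vi mulr0 eqxx in nz0.
  by exists `|i - a|%N; [rewrite mem_iota; lia | lia].
Qed.

Lemma conv_vanishes u v a b : vanishes_below u a -> vanishes_below v b ->
  vanishes_below (conv u v) (a + b).
Proof.
by move=> ua vb m mab; rewrite (convE ua vb (N := 0)) ?big_ord0 //; lia.
Qed.

Let trunc u a (N : nat) : {poly k} := \poly_(j < N) u (a + j%:Z).

Let conv_trunc u v a b : vanishes_below u a -> vanishes_below v b ->
  forall n N : nat, (n < N)%N ->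
  conv u v (a + b + n%:Z) = (trunc u a N * trunc v b N)`_n.
Proof.
move=> ua vb n N nN; rewrite (convE ua vb (N := n.+1)); last by lia.
rewrite coefM; apply: eq_bigr => -[j /= jn] _.
rewrite !coef_poly !ifT; [| lia | lia].
by congr (_ * v _); lia.
Qed.

Let eq_above u v a : vanishes_below u a -> vanishes_below v a ->
  (forall n : nat, u (a + n%:Z) = v (a + n%:Z)) -> forall i, u i = v i.
Proof.
move=> ua va uv i; have [ia|ai] := ltP i a; first by rewrite ua ?va.
by have -> : i = a + `|i - a|%N%:Z by lia.
Qed.

Let convC u v : (exists a, vanishes_below u a) -> (exists b, vanishes_below v b) ->
  forall m, conv u v m = conv v u m.
Proof.
move=> [a ua] [b vb].
apply: (eq_above (conv_vanishes ua vb)).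
  by rewrite addrC; apply: conv_vanishes.
move=> n; rewrite (conv_trunc ua vb (ltnSn n)) mulrC -(conv_trunc vb ua) //.
by rewrite (addrC b).
Qed.

Let convA u v w : (exists a, vanishes_below u a) ->
  (exists b, vanishes_below v b) -> (exists c, vanishes_below w c) ->
  forall m, conv u (conv v w) m = conv (conv u v) w m.
Proof.
move=> [a ua] [b vb] [c wc].
have vwbc := conv_vanishes vb wc; have uvab := conv_vanishes ua vb.
apply: (eq_above (conv_vanishes ua vwbc)).
  by rewrite addrA; apply: conv_vanishes.
move=> n; rewrite (conv_trunc ua vwbc (ltnSn n)).
have -> : a + (b + c) = a + b + c by rewrite addrA.
rewrite (conv_trunc uvab wc (ltnSn n)).
transitivity (trunc u a n.+1 * (trunc v b n.+1 * trunc w c n.+1))`_n.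
  rewrite !coefM; apply: eq_bigr => -[j /= jn] _; congr (_ * _).
  by rewrite coef_poly ifT ?(conv_trunc vb wc (N := n.+1)) //; lia.
rewrite mulrA !coefM; apply: eq_bigr => -[j /= jn] _; congr (_ * _).
by rewrite coef_poly ifT ?(conv_trunc ua vb (N := n.+1)) //; lia.
Qed.

Let delta0 i : k := (i == 0)%:R.

Let delta0_vanishes : vanishes_below delta0 0.
Proof. by move=> i i0; rewrite /delta0 (lt_eqF i0). Qed.

Let conv1u u : (exists a, vanishes_below u a) -> forall m, conv delta0 u m = u m.
Proof.
move=> [a ua]; apply: (@eq_above _ _ a) => //.
  by rewrite -[a]add0r; apply: conv_vanishes.
move=> n; rewrite -{1}[a]add0r (conv_trunc delta0_vanishes ua (ltnSn n)).
have -> : trunc delta0 0 n.+1 = 1.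
  apply/polyP => j; rewrite coef_poly coef1 /delta0 add0r.
  by case: j => [//|j]; case: ifP.
by rewrite mul1r coef_poly ltnSn.
Qed.

Let convDl u v w : (exists a, vanishes_below u a) ->
  (exists b, vanishes_below v b) -> (exists c, vanishes_below w c) ->
  forall m, conv (fun i => u i + v i) w m = conv u w m + conv v w m.
Proof.
move=> [a0 ua0] [b0 vb0] [c wc]; pose a := Num.min a0 b0.
have ua : vanishes_below u a by apply: vanishes_belowW ua0; rewrite ge_min lexx.
have va : vanishes_below v a by apply: vanishes_belowW vb0; rewrite ge_min lexx orbT.
have uva : vanishes_below (fun i => u i + v i) a.
  by move=> i ia; rewrite ua ?va ?addr0.
apply: (eq_above (conv_vanishes uva wc)).
  by move=> i iac; rewrite (conv_vanishes ua wc) // (conv_vanishes va wc) // addr0.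
move=> n; rewrite (conv_trunc uva wc (ltnSn n)) (conv_trunc ua wc (ltnSn n)).
rewrite (conv_trunc va wc (ltnSn n)) -coefD -mulrDl; congr (nth 0 (polyseq (_ * _)) n).
by apply/polyP => j; rewrite coefD !coef_poly; case: ifP => // _; rewrite addr0.
Qed.

Fact lzero_bounded : exists a, vanishes_below (fun=> 0) a.
Proof. by exists 0. Qed.
Definition lzero := Laurent lzero_bounded.

Fact lopp_bounded (f : laurent) : exists a, vanishes_below (fun i => - f i) a.
Proof. by have [a fa] := lcoef_bounded f; exists a => i /fa ->; rewrite oppr0. Qed.
Definition lopp f := Laurent (lopp_bounded f).

Fact ladd_bounded (f g : laurent) :
  exists a, vanishes_below (fun i => f i + g i) a.
Proof.
have [a fa] := lcoef_bounded f; have [b gb] := lcoef_bounded g.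
exists (Num.min a b) => i; rewrite lt_min => /andP[ia ib].
by rewrite fa ?gb ?addr0.
Qed.
Definition ladd f g := Laurent (ladd_bounded f g).

Fact lmonomial_bounded a : exists b, vanishes_below (fun i => (i == a)%:R) b.
Proof. by exists a => i ia; rewrite (lt_eqF ia). Qed.
Definition lmonomial a := Laurent (lmonomial_bounded a).

Fact lmul_bounded (f g : laurent) : exists a, vanishes_below (conv f g) a.
Proof.
have [a fa] := lcoef_bounded f; have [b gb] := lcoef_bounded g.
by exists (a + b); apply: conv_vanishes.
Qed.
Definition lmul f g := Laurent (lmul_bounded f g).

Let laddA : associative ladd.
Proof. by move=> f g h; apply: laurentP => i /=; rewrite addrA. Qed.
Let laddC : commutative ladd.
Proof. by move=> f g; apply: laurentP => i /=; rewrite addrC. Qed.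
Let ladd0 : left_id lzero ladd.
Proof. by move=> f; apply: laurentP => i /=; rewrite add0r. Qed.
Let laddN : left_inverse lzero lopp ladd.
Proof. by move=> f; apply: laurentP => i /=; rewrite addNr. Qed.

HB.instance Definition _ := GRing.isZmodule.Build laurent laddA laddC ladd0 laddN.

Let lmulA : associative lmul.
Proof. by move=> f g h; apply: laurentP => i /=; apply: convA; apply: lcoef_bounded. Qed.
Let lmulC : commutative lmul.
Proof. by move=> f g; apply: laurentP => i /=; apply: convC; apply: lcoef_bounded. Qed.
Let lmul1 : left_id (lmonomial 0) lmul.
Proof. by move=> f; apply: laurentP => i /=; apply: conv1u; apply: lcoef_bounded. Qed.
Let lmulDl : left_distributive lmul ladd.
Proof. by move=> f g h; apply: laurentP => i /=; apply: convDl; apply: lcoef_bounded. Qed.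
Let lone_neq0 : lmonomial 0 != lzero.
Proof.
apply/eqP => /(congr1 (fun f : laurent => f 0)) /eqP.
exact/negP/oner_neq0.
Qed.

HB.instance Definition _ :=
  GRing.Zmodule_isComNzRing.Build laurent lmulA lmulC lmul1 lmulDl lone_neq0.

Lemma lcoef0 i : (0 : laurent) i = 0. Proof. by []. Qed.
Lemma lcoef1 i : (1 : laurent) i = (i == 0)%:R. Proof. by []. Qed.
Lemma lcoefN (f : laurent) i : (- f) i = - f i. Proof. by []. Qed.
Lemma lcoefD (f g : laurent) i : (f + g) i = f i + g i. Proof. by []. Qed.
Lemma lcoefM (f g : laurent) m :
  (f * g) m = \sum_(i \in [set: int]) f i * g (m - i).
Proof. by []. Qed.

Definition order_at (f : laurent) a := f a != 0 /\ vanishes_below f a.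

Lemma order_at_ex (f : laurent) : f != 0 -> exists a, order_at f a.
Proof.
move=> f0; have [a fa] := lcoef_bounded f.
have exn : exists n : nat, f (a + n%:Z) != 0.
  apply: contrapT => /forallNP nz; case/eqP: f0; apply: laurentP.
  apply: (eq_above fa) => [i //|n]; apply/eqP.
  by move/negP: (nz n); rewrite negbK.
case: (ex_minnP exn) => n fn min_n; exists (a + n%:Z); split=> // i ia.
have [/fa//|ai] := ltP i a; apply/eqP/negPn/negP => fi.
have iE : a + `|i - a|%N%:Z = i by lia.
by have := min_n `|i - a|%N; rewrite iE => /(_ fi); lia.
Qed.

Lemma order_at_inj (f : laurent) a b : order_at f a -> order_at f b -> a = b.
Proof.
move=> [fa0 fa] [fb0 fb]; apply/eqP; rewrite eq_le !leNgt; apply/andP; split.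
  by apply/negP => /fa /eqP; apply/negP.
by apply/negP => /fb /eqP; apply/negP.
Qed.

(* Coefficients of the inverse of the power series with coefficients c. *)
Let inv_seq (c : nat -> k) : nat -> seq k :=
  fix s n := if n is n'.+1 then
    rcons (s n') ((c 0)^-1 *
      ((n' == 0)%:R - \sum_(i < n') c i.+1 * (s n')`_(n' - i.+1)))
  else [::].

Let linv_ex (f : laurent) : f != 0 -> exists g : laurent, g * f = 1.
Proof.
move=> /order_at_ex[a [fa0 fa]].
pose c (n : nat) := f (a + n%:Z); pose s := inv_seq c.
have size_s n : size (s n) = n by elim: n => //= n IHn; rewrite size_rcons IHn.
have sS n : s n.+1 = rcons (s n) ((c 0)^-1 *
  ((n == 0)%:R - \sum_(i < n) c i.+1 * (s n)`_(n - i.+1))) by [].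
pose d n := (s n.+1)`_n.
have s_d (n i : nat) : (i < n)%N -> (s n)`_i = d i.
  elim: n => // n IHn; rewrite ltnS leq_eqVlt => /predU1P[->//|ltin].
  by rewrite sS nth_rcons size_s ltin IHn.
have dE n : \sum_(i < n.+1) c i * d (n - i)%N = (n == 0)%:R.
  rewrite big_ord_recl subn0 {1}/d sS nth_rcons size_s ltnn eqxx mulrA.
  rewrite divff ?mul1r; last by rewrite /c addr0.
  rewrite -addrA -[RHS]addr0; congr (_ + _).
  rewrite addrC; apply/eqP; rewrite subr_eq0; apply/eqP; apply: eq_bigr => i _.
  by rewrite s_d //; have := ltn_ord i; lia.
pose v i := if (i < - a) then 0 else d `|(i + a)%R|%N.
have va : vanishes_below v (- a) by rewrite /v => i ->.
exists (Laurent (ex_intro _ _ va)); rewrite mulrC; apply: laurentP => m.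
change (conv f v m = delta0 m).
apply: (eq_above (conv_vanishes fa va)) => [|n]; first by rewrite subrr.
rewrite subrr add0r (convE fa va (N := n.+1)); last by lia.
rewrite /delta0 -[RHS]/((n == 0)%:R) -dE; apply: eq_bigr => -[i /= ltin] _.
by congr (_ * _); rewrite /v ifF; [congr d|]; lia.
Qed.

Definition linv (f : laurent) : laurent :=
  if pselect (exists g : laurent, g * f = 1) is left ex_g
  then projT1 (cid ex_g) else 0.

Let lmulVf (f : laurent) : f != 0 -> linv f * f = 1.
Proof.
move=> f0; rewrite /linv; case: pselect => [ex_g|[]]; last exact: linv_ex.
by case: (cid ex_g).
Qed.

Let linv0 : linv 0 = 0.
Proof.
rewrite /linv; case: pselect => // ex_g; have [g /eqP] := ex_g.
by rewrite mulr0 eq_sym oner_eq0.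
Qed.

HB.instance Definition _ := GRing.ComNzRing_isField.Build laurent lmulVf linv0.

Definition lval (f : laurent) : \bar int :=
  if pselect (exists a, order_at f a) is left ex_a
  then (projT1 (cid ex_a))%:E else +oo%E.

Lemma lval0 : lval 0 = +oo%E.
Proof. by rewrite /lval; case: pselect => // ex_a; have [a [/eqP]] := ex_a. Qed.

Lemma lvalE (f : laurent) a : order_at f a -> lval f = a%:E.
Proof.
move=> fa; rewrite /lval; case: pselect => [ex_a|[]]; last by exists a.
by case: (cid ex_a) => b /= fb; rewrite (order_at_inj fa fb).
Qed.

Definition leps : laurent := lmonomial 1.

Definition power_series (f : laurent) : Prop := vanishes_below f 0.

Definition power_series_unit (f : laurent) : Prop :=
  power_series f /\ exists2 g, power_series g & f * g = 1.

Definition eps_power_series (f : laurent) : Prop :=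
  exists2 g, power_series g & f = leps * g.

End LaurentSeries.

Arguments leps {k}.

Variant linear_group := SL | GL.

Section Iwahori.
Variables (k : fieldType) (G : linear_group) (n : nat).
Local Notation L := (laurent k).

Definition L_points (M : 'M[L]_n) : Prop :=
  match G with SL => \det M = 1 | GL => M \in unitmx end.

Definition iwahori (M : 'M[L]_n) : Prop :=
  [/\ L_points M,
      forall i j, power_series (M i j),
      forall i, power_series_unit (M i i) &
      forall i j : 'I_n, (j < i)%N -> eps_power_series (M i j)].

(* X_*(A): the cocharacter t |-> diag(t ^ l_1, ..., t ^ l_n) is given by l. *)
Definition cocharacter : Type :=
  {l : 'rV[int]_n | if G is SL then \sum_i l 0 i == 0 else true}.

(* The underlying set of the semidirect product of W = 'S_n and X_*(A); the   *)
(* pair (w, l) stands for the product eps^l w.                                *)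
Definition ext_affine_weyl : Type := ('S_n * cocharacter)%type.

Definition monomial_mx (x : ext_affine_weyl) : 'M[L]_n :=
  diag_mx (\row_i leps ^ (sval x.2 0 i)) *m perm_mx x.1.

Definition negate_row (i0 : 'I_n) (N : 'M[L]_n) : 'M[L]_n :=
  \matrix_(i, j) (if i == i0 then - N i j else N i j).

(* In a monomial matrix negating a row changes the sign of a single nonzero   *)
(* entry; for SL this is needed exactly when monomial_mx x has determinant -1.*)
Definition representative (x : ext_affine_weyl) (N : 'M[L]_n) : Prop :=
  match G with
  | GL => N = monomial_mx x
  | SL => \det N = 1 /\
      (N = monomial_mx x \/ exists i, N = negate_row i (monomial_mx x))
  end.

Definition iwahori_coset (x : ext_affine_weyl) (M : 'M[L]_n) : Prop :=
  exists g N h,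
    [/\ iwahori g, representative x N, iwahori h & M = g *m N *m h].

End Iwahori.

(* enum_val lists R and C in increasing order. *)
Definition minor (K : comNzRingType) (n m : nat) (R C : {set 'I_n})
    (cardR : #|R| = m) (cardC : #|C| = m) (M : 'M[K]_n) : K :=
  \det (mxsub (fun i : 'I_m => enum_val (cast_ord (esym cardR) i))
              (fun j : 'I_m => enum_val (cast_ord (esym cardC) j)) M).

(* Main.v *)
(* Choose integer weights lam, mu decreasing in the index with total spread    *)
(* less than N. Conjugating by such weights makes the Iwahori subgroup         *)
(* integral with entries off the diagonal of positive weight, so for each m    *)
(* the minimum over all m x m minors of                                        *)
(*   N * val (minor) + \sum_(rows) lam - \sum_(columns) mu                     *)
(* is constant on each double coset. On the monomial matrix eps^l w it is the  *)
(* sum of the m smallest values a_i = N * l_i + lam_i - mu_(w i), so the minors*)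
(* determine the multiset of the a_i. With N = n^2, lam_i = - n * i and        *)
(* mu_j = - j, the number a_i determines i, w i and l_i by its base n digits.  *)
Require Import Defs.
From mathcomp Require Import all_boot all_order all_fingroup all_algebra all_field.
From mathcomp Require Import boolp fsbigop.
From mathcomp Require Import zify ring lra.

Set Implicit Arguments.
Unset Strict Implicit.
Unset Printing Implicit Defensive.

Import Order.TTheory GRing.Theory Num.Theory.

Local Open Scope ring_scope.

(** With strictly decreasing weights of total spread less than [N], conjugation by fractional powers
    of epsilon makes an Iwahori matrix integral and, modulo positive weight, diagonal and invertible
    ([iwahori_weighted_unipotent]). Multiplication by it or its inverse preserves every lower bound
    on the weighted valuations of the [m] by [m] minors, so the bounds valid for a matrix depend
    only on its double coset ([minors_ge_double_coset]). On the monomial representative they bound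
    sums of [m] of the numbers [a_i = N l_i + lam_i - mu_(w i)] ([minors_ge_monomial]). Bounds for
    all [m] together determine the values [a_i] ([eq_subset_sums_values]), and generic weights make
    each [a_i] encode [i], [w i] and [l_i]. *)

(** * Orders of Laurent series and scaled valuation bounds *)

Section LaurentOrder.
Variable k : fieldType.
Implicit Types (f g : laurent k) (a b v w : int).

Lemma lcoef_sum (I : finType) (P : pred I) (F : I -> laurent k) i :
  (\sum_(j | P j) F j) i = \sum_(j | P j) F j i.
Proof.
exact: (big_morph (fun f : laurent k => f i) (fun f g => lcoefD f g i)).
Qed.

Lemma order_at1 : order_at (1 : laurent k) 0.
Proof.
by split=> [|i i0]; rewrite lcoef1 ?eqxx ?oner_eq0 // (lt_eqF i0).
Qed.

Lemma lcoefM_lowest f g a b : vanishes_below f a -> vanishes_below g b ->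
  (f * g) (a + b) = f a * g b.
Proof.
move=> fa gb; rewrite -[LHS]/(conv f g (a + b)) (convE fa gb (N := 1));
  last by lia.
by rewrite big_ord1 /=; congr (f _ * g _); lia.
Qed.

Lemma order_atM f g a b :
  order_at f a -> order_at g b -> order_at (f * g) (a + b).
Proof.
move=> [fa0 fa] [gb0 gb]; split; first by rewrite lcoefM_lowest // mulf_neq0.
exact: conv_vanishes.
Qed.

Lemma order_at_neq0 f a : order_at f a -> f != 0.
Proof. by move=> [fa0 _]; apply: contraNneq fa0 => ->; rewrite lcoef0. Qed.

Lemma order_atV f a : order_at f a -> order_at f^-1 (- a).
Proof.
move=> fa; have f0 := order_at_neq0 fa.
have [|b gb] := @order_at_ex _ f^-1; first by rewrite invr_eq0.
have := order_atM fa gb; rewrite divff // => /(order_at_inj order_at1) ab.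
by have <- : b = - a by lia.
Qed.

Lemma order_at_leps_exp (l : int) : order_at (leps ^ l : laurent k) l.
Proof.
have lepsX (m : nat) : order_at (leps ^+ m : laurent k) m.
  elim: m => [|m IHm]; first exact: order_at1.
  rewrite exprS intS; apply: order_atM => //.
  by split=> [|i i1]; rewrite /= ?eqxx ?oner_eq0 // (lt_eqF i1).
case: l => m; first exact: lepsX.
by rewrite NegzE -exprnN; apply/order_atV/lepsX.
Qed.

Lemma order_at_sign f a (s : bool) : order_at f a -> order_at ((-1) ^+ s * f) a.
Proof.
case: s; rewrite ?mul1r // expr1 mulN1r => -[fa0 fa].
by split=> [|i /fa]; rewrite lcoefN ?oppr_eq0 // => ->; rewrite oppr0.
Qed.

Lemma order_at_prod (I : finType) (F : I -> laurent k) (a : I -> int) :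
  (forall i, order_at (F i) (a i)) -> order_at (\prod_i F i) (\sum_i a i).
Proof.
move=> Fa; elim/big_rec2: _ => [|i b f _ fb]; first exact: order_at1.
exact: order_atM.
Qed.

Lemma order_at_power_series_unit f : power_series_unit f -> order_at f 0.
Proof.
move=> [f0 [g g0 fg]]; split=> //; apply/eqP => f00.
have /eqP := lcoefM_lowest f0 g0.
by rewrite fg f00 mul0r addr0 lcoef1 eqxx oner_eq0.
Qed.

(* [N * val f >= v], in a form that also makes sense for [f = 0]. *)
Definition scaled_val_ge (N v : int) f := forall i, N * i < v -> f i = 0.

Section Scaled.
Variable N : int.
Local Notation ge := (scaled_val_ge N).

Lemma scaled_val_geW v w f : w <= v -> ge v f -> ge w f.
Proof. by move=> wv fv i iw; apply: fv; apply: lt_le_trans wv. Qed.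

Lemma scaled_val_geD v f g : ge v f -> ge v g -> ge v (f + g).
Proof. by move=> fv gv i iv; rewrite lcoefD fv ?gv ?addr0. Qed.

Lemma scaled_val_ge_sum (I : finType) (P : pred I) (F : I -> laurent k) v :
  (forall i, P i -> ge v (F i)) -> ge v (\sum_(i | P i) F i).
Proof. by move=> Fv; apply: big_ind => //; apply: scaled_val_geD. Qed.

Lemma scaled_val_geM v w f g : ge v f -> ge w g -> ge (v + w) (f * g).
Proof.
move=> fv gw m mvw; rewrite lcoefM fsbig1 // => i _.
have [/fv->|vi] := ltP (N * i) v; first by rewrite mul0r.
by rewrite (gw (m - i)) ?mulr0 //; lia.
Qed.

Hypothesis N_gt0 : 0 < N.

Lemma scaled_val_ge_order v f a : order_at f a -> ge v f <-> v <= N * a.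
Proof.
move=> [fa0 fa]; split=> [fv|va i iv].
  by rewrite leNgt; apply/negP => /fv /eqP; apply/negP.
by apply: fa; rewrite -(ltr_pM2l N_gt0); apply: lt_le_trans va.
Qed.

Lemma scaled_val_ge1 : ge 0 1.
Proof. by apply/(scaled_val_ge_order _ order_at1); rewrite mulr0. Qed.

Lemma scaled_val_ge_prod (I : finType) (F : I -> laurent k) (v : I -> int) :
  (forall i, ge (v i) (F i)) -> ge (\sum_i v i) (\prod_i F i).
Proof.
move=> Fv; elim/big_rec2: _ => [|i w f _ fw]; first exact: scaled_val_ge1.
exact: scaled_val_geM.
Qed.

Lemma scaled_val_ge_sign v f (m : nat) : ge v f -> ge v ((-1) ^+ m * f).
Proof.
move=> fv i /fv; rewrite -signr_odd; case: (odd m); rewrite ?mul1r // expr1.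
by rewrite mulN1r lcoefN => ->; rewrite oppr0.
Qed.

Lemma scaled_val_ge_lval v f g : lval f = lval g -> ge v f -> ge v g.
Proof.
have [->|/order_at_ex[b gb]] := eqVneq g 0; first by [].
rewrite (lvalE gb) => fg /=.
have [f0|/order_at_ex[a fa]] := eqVneq f 0; first by rewrite f0 lval0 in fg.
move: fg; rewrite (lvalE fa) => -[ab].
by move/(scaled_val_ge_order _ fa); rewrite ab; move/(scaled_val_ge_order _ gb).
Qed.

(** Each term of the determinant takes one entry from every row and every column, so it collects all
    the row and column weights. *)
Lemma scaled_val_ge_det m (A : 'M[laurent k]_m) (r c : 'I_m -> int) :
  (forall i j, ge (r i + c j) (A i j)) ->
  ge (\sum_i r i + \sum_i c i) (\det A).
Proof.
move=> Arc; apply: scaled_val_ge_sum => s _; apply: scaled_val_ge_sign.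
rewrite [X in _ + X](reindex_inj (@perm_inj _ s)) -big_split /=.
exact: scaled_val_ge_prod.
Qed.

End Scaled.
End LaurentOrder.

(** Multilinearity in the columns of the product. Summing over all maps [d], not only increasing
    ones as in Cauchy-Binet, avoids sorting and signs. *)
Lemma det_mulmx_colsub (R : comNzRingType) (m n : nat)
    (A : 'M[R]_(m, n)) (B : 'M[R]_(n, m)) :
  \det (A *m B) =
  \sum_(d : {ffun 'I_m -> 'I_n}) (\prod_j B (d j) j) * \det (colsub d A).
Proof.
rewrite -det_tr /determinant.
under eq_bigr => s _ do under eq_bigr => i _ do rewrite !mxE.
under eq_bigr => s _ do rewrite bigA_distr_bigA big_distrr /=.
rewrite exchange_big; apply: eq_bigr => d _.
rewrite -/(determinant _) -[\det (colsub _ _)]det_tr /determinant big_distrr /=.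
apply: eq_bigr => s _; rewrite mulrCA; congr (_ * _).
rewrite -big_split /=; apply: eq_bigr => i _.
by rewrite !mxE mulrC.
Qed.

(** * Weighted bounds on minors *)

Section MinorWeights.
Variables (k : fieldType) (N : int) (n : nat).
Hypothesis N_gt0 : 0 < N.
Local Notation L := (laurent k).
Local Notation ge := (scaled_val_ge N).
Implicit Types (lam mu : 'I_n -> int) (M g h : 'M[L]_n).

(** Arbitrary maps [r] and [c] add no condition beyond the true minors: a repeated index gives
    determinant zero, a reordering only a sign. *)
Definition minors_ge m lam mu v M :=
  forall r c : 'I_m -> 'I_n,
    ge (v - \sum_j lam (r j) + \sum_j mu (c j)) (\det (mxsub r c M)).

(** Integrality after conjugation by the formal diagonal matrix with entries [eps^(lam_i / N)]. *)
Definition weighted_integral lam g :=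
  forall i j, ge (lam j - lam i) (g i j).

Lemma minors_ge_mulr m lam mu v M h : weighted_integral mu h ->
  minors_ge m lam mu v M -> minors_ge m lam mu v (M *m h).
Proof.
move=> h_int Mv r c; rewrite mxsub_mul det_mulmx_colsub.
apply: scaled_val_ge_sum => d _.
rewrite (_ : _ + _ = (\sum_j (mu (c j) - mu (d j))) +
   (v - \sum_j lam (r j) + \sum_j mu (d j))); last first.
  by rewrite sumrB; ring.
apply: scaled_val_geM.
  by apply: scaled_val_ge_prod => // j; rewrite mxE; apply: h_int.
by rewrite (_ : colsub d _ = mxsub r d M) //; apply/matrixP => i j; rewrite !mxE.
Qed.

Lemma minors_ge_tr m lam mu v M : minors_ge m lam mu v M ->
  minors_ge m (fun i => - mu i) (fun i => - lam i) v M^T.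
Proof.
move=> Mv r c; rewrite -trmx_mxsub det_tr !sumrN opprK addrAC; exact: Mv.
Qed.

Lemma weighted_integral_tr lam g : weighted_integral lam g ->
  weighted_integral (fun i => - lam i) g^T.
Proof. by move=> g_int i j; rewrite mxE opprK addrC; apply: g_int. Qed.

Lemma minors_ge_mull m lam mu v g M : weighted_integral lam g ->
  minors_ge m lam mu v M -> minors_ge m lam mu v (g *m M).
Proof.
move=> /weighted_integral_tr g_int /minors_ge_tr Mv.
have := minors_ge_tr (minors_ge_mulr g_int Mv); rewrite trmx_mul !trmxK => gMv r c.
by have := gMv r c; rewrite !(eq_bigr _ (fun _ _ => opprK _)).
Qed.

(** The cofactor omits row [j] and column [i]; the remaining row and column weights cancel down to
    [lam j - lam i]. *)
Lemma weighted_integral_adj lam g :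
  weighted_integral lam g -> weighted_integral lam (\adj g).
Proof.
move=> g_int i j; rewrite mxE; apply: scaled_val_ge_sign.
have : ge (\sum_a - lam (lift j a) + \sum_b lam (lift i b))
          (\det (row' j (col' i g))).
  by apply: scaled_val_ge_det => // a b; rewrite !mxE addrC; apply: g_int.
apply: scaled_val_geW; rewrite sumrN.
have lamD (i0 : 'I_n) : \sum_i lam i = lam i0 + \sum_a lam (lift i0 a).
  exact: bigD1_ord.
by rewrite lerBlDr -addrA [_ + lam i]addrC -lamD (lamD j) addrC addrK.
Qed.

(** The reduction modulo positive weight is diagonal with nonzero entries, not necessarily the
    identity. Since weights are integers, [+ 1] expresses strict positivity. *)
Definition weighted_unipotent lam g :=
  (forall i j, i != j -> ge (lam j - lam i + 1) (g i j)) /\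
  (forall i, order_at (g i i) 0).

Lemma weighted_unipotent_integral lam g :
  weighted_unipotent lam g -> weighted_integral lam g.
Proof.
move=> [g_off g_diag] i j; have [->|/g_off] := eqVneq i j.
  by apply/(scaled_val_ge_order N_gt0 _ (g_diag j)); rewrite subrr mulr0.
by apply: scaled_val_geW; rewrite lerDl.
Qed.

(** The weights cancel along any permutation, and each moved index gains 1. Hence only the identity
    permutation contributes to the constant coefficient. *)
Lemma order_at_det_unipotent lam g :
  weighted_unipotent lam g -> order_at (\det g) 0.
Proof.
move=> g_uni; have [g_off g_diag] := g_uni.
have g_int := weighted_unipotent_integral g_uni; split; last first.
  have : ge (\sum_i - lam i + \sum_i lam i) (\det g).
    by apply: scaled_val_ge_det => // i j; rewrite addrC; apply: g_int.
  by rewrite sumrN addNr => det0 i i0; apply: det0; rewrite pmulr_rlt0.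
rewrite /determinant (bigD1 1%g) // lcoefD lcoef_sum.
rewrite [X in _ + X]big1 => [|s s1].
  rewrite addr0 odd_perm1 expr0 mul1r.
  rewrite (eq_bigr (fun i => g i i)) => [|i _]; last by rewrite perm1.
  by have := order_at_prod g_diag; rewrite big1_eq; case.
have [i0 si0] : exists i, s i != i.
  apply/existsP; apply: contraNT s1 => /existsPn s_id; apply/eqP/permP => i.
  by rewrite perm1; apply/eqP; rewrite -[_ == _]negbK; apply: s_id.
suff : ge 1 (\prod_i g i (s i)).
  by move=> /(scaled_val_ge_sign (s : bool)) ge1; apply: ge1; rewrite mulr0.
have : ge (\sum_i (lam (s i) - lam i + (s i != i)%:R)) (\prod_i g i (s i)).
  apply: scaled_val_ge_prod => // i; have [si|si] := eqVneq (s i) i.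
    by rewrite addr0; apply: g_int.
  by apply: g_off; rewrite eq_sym.
apply: scaled_val_geW; rewrite big_split /= sumrB.
rewrite [X in _ - X](reindex_inj (@perm_inj _ s)) subrr add0r (bigD1 i0) //=.
rewrite si0 lerDl.
by apply: sumr_ge0 => i _; apply: ler0n.
Qed.

Lemma weighted_integral_inv lam g : weighted_unipotent lam g ->
  exists2 g', weighted_integral lam g' & g' *m g = 1%:M /\ g *m g' = 1%:M.
Proof.
move=> g_uni; have detg := order_at_det_unipotent g_uni.
exists ((\det g)^-1 *: \adj g) => [i j|].
  rewrite mxE -[X in ge X]add0r; apply: scaled_val_geM.
    by apply/(scaled_val_ge_order N_gt0 _ (order_atV detg)); rewrite oppr0 mulr0.
  exact/weighted_integral_adj/weighted_unipotent_integral.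
rewrite -scalemxAl -scalemxAr mul_mx_adj mul_adj_mx scale_scalar_mx.
by rewrite mulVf // (order_at_neq0 detg).
Qed.

Lemma minors_ge_double_coset m lam mu v g M h :
  weighted_unipotent lam g -> weighted_unipotent mu h ->
  minors_ge m lam mu v (g *m M *m h) <-> minors_ge m lam mu v M.
Proof.
move=> g_uni h_uni.
have [g' g'_int [g'g _]] := weighted_integral_inv g_uni.
have [h' h'_int [_ hh']] := weighted_integral_inv h_uni.
split=> [gMhv|Mv].
  have := minors_ge_mulr h'_int (minors_ge_mull g'_int gMhv).
  by rewrite !mulmxA g'g mul1mx -mulmxA hh' mulmx1.
apply/minors_ge_mulr/minors_ge_mull => //; exact: weighted_unipotent_integral.
Qed.

Lemma minors_ge_monomial m lam mu v (w : 'S_n) (l : 'I_n -> int)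
    (s : 'I_n -> bool) M :
  (forall i j, M i j = (-1) ^+ s i * leps ^ l i *+ (w i == j)) ->
  minors_ge m lam mu v M <->
  (forall r : 'I_m -> 'I_n, injective r ->
     v <= \sum_j (N * l (r j) + lam (r j) - mu (w (r j)))).
Proof.
move=> ME; have entry i : order_at ((-1) ^+ s i * leps ^ l i : L) (l i).
  exact/order_at_sign/order_at_leps_exp.
split=> [Mv r r_inj|a_ge r c].
  (* The columns [w \o r] cut out a diagonal submatrix, on which the bound is sharp. *)
  have detE : \det (mxsub r (w \o r) M) =
      \prod_j ((-1) ^+ s (r j) * leps ^ l (r j)).
    rewrite (_ : mxsub _ _ _ = diag_mx (\row_j ((-1) ^+ s (r j) * leps ^ l (r j)))).
      by rewrite det_diag; apply: eq_bigr => j _; rewrite mxE.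
    apply/matrixP => i j; rewrite !mxE ME /= (inj_eq perm_inj) (inj_eq r_inj).
    by [].
  have := Mv r (w \o r); rewrite detE.
  move=> /(scaled_val_ge_order N_gt0 _ (order_at_prod (fun j => entry (r j)))).
  rewrite sumrB big_split /= -mulr_sumr; lra.
have [r_inj|] := boolP (injectiveb r).
  (* Row weight [N * l i - mu (w i)] and column weight [mu j] bound every entry: they add up to
     [N * l i] where [j = w i], and all other entries vanish. *)
  have : ge (\sum_j (N * l (r j) - mu (w (r j))) + \sum_j mu (c j))
            (\det (mxsub r c M)).
    apply: scaled_val_ge_det => // i j; rewrite mxE ME.
    have [<-|_] := eqVneq; last by rewrite mulr0n.
    by rewrite mulr1n subrK; apply/(scaled_val_ge_order N_gt0 _ (entry _)).
  apply: scaled_val_geW; have /a_ge := injectiveP _ r_inj.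
  rewrite !sumrB big_split /=; lra.
move=> /injectivePn[i [j ij rij]].
rewrite (determinant_alternate ij) // => a; by rewrite !mxE rij.
Qed.

Lemma det_mxsub_minor m (r c : 'I_m -> 'I_n) : injective r -> injective c ->
  exists (R C : {set 'I_n}) (cardR : #|R| = m) (cardC : #|C| = m) (s : bool),
    forall M, \det (mxsub r c M) = (-1) ^+ s * minor cardR cardC M.
Proof.
have sort_inj (e : 'I_m -> 'I_n) : injective e -> exists (E : {set 'I_n})
    (cardE : #|E| = m) (s : 'S_m), forall i,
    e i = enum_val (cast_ord (esym cardE) (s i)).
  move=> e_inj; pose E := [set e i | i in 'I_m].
  have cardE : #|E| = m by rewrite card_imset // card_ord.
  have eE i : e i \in E by apply: imset_f.
  have s_inj : injective (fun i => cast_ord cardE (enum_rank_in (eE i) (e i))).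
    move=> i j /cast_ord_inj /(congr1 enum_val).
    by rewrite !enum_rankK_in // => /e_inj.
  exists E, cardE, (perm s_inj) => i.
  by rewrite permE cast_ordK enum_rankK_in.
move=> /sort_inj[R [cardR [s rs]]] /sort_inj[C [cardC [t ct]]].
exists R, C, cardR, cardC, (s (+) t) => M; set A := mxsub _ _ _.
pose B := mxsub (fun i : 'I_m => enum_val (cast_ord (esym cardR) i))
                (fun j : 'I_m => enum_val (cast_ord (esym cardC) j)) M.
have -> : A = row_perm s (col_perm t B).
  by apply/matrixP => i j; rewrite !mxE rs ct.
rewrite row_permE col_permE !det_mulmx !det_perm odd_permV signr_addb.
by rewrite mulrCA mulrC.
Qed.

Lemma minors_ge_lval m lam mu v M M' :
  (forall (R C : {set 'I_n}) (cardR : #|R| = m) (cardC : #|C| = m),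
     (1 <= m <= n)%N ->
     lval (minor cardR cardC M) = lval (minor cardR cardC M')) ->
  minors_ge m lam mu v M -> minors_ge m lam mu v M'.
Proof.
(* Size zero lies outside [eq_val], but both empty determinants are 1. *)
move=> eq_val Mv r c; have [m0|m_gt0] := posnP m.
  by have := Mv r c; move: r c; rewrite m0 => r c; rewrite !det_mx00.
have [r_inj|] := boolP (injectiveb r); last first.
  move=> /injectivePn[i [j ij rij]].
  by rewrite (determinant_alternate ij) // => a; rewrite !mxE rij.
have [c_inj|] := boolP (injectiveb c); last first.
  move=> /injectivePn[i [j ij cij]]; rewrite -det_tr.
  by rewrite (determinant_alternate ij) // => a; rewrite !mxE cij.
have [R [C [cardR [cardC [s detE]]]]] :=
  det_mxsub_minor (injectiveP _ r_inj) (injectiveP _ c_inj).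
have mn : (1 <= m <= n)%N.
  by rewrite m_gt0 -cardR -[X in (_ <= X)%N]card_ord max_card.
rewrite detE; apply: scaled_val_ge_sign.
apply: (scaled_val_ge_lval N_gt0 (eq_val R C cardR cardC mn)).
have := scaled_val_ge_sign s (Mv r c).
by rewrite detE mulrA -signr_addb addbb mul1r.
Qed.

End MinorWeights.

(* The bound below is attained by the set of indices with [a i < t], so these *)
(* infima determine the piecewise linear function [\sum_i min (a i - t) 0] of *)
(* [t], whose slopes count the [i] with [a i <= t].                           *)
Lemma eq_subset_sums_values (n : nat) (a a' : 'I_n -> int) :
  (forall v t : int, (forall R : {set 'I_n}, v <= \sum_(i in R) (a i - t)) <->
               (forall R : {set 'I_n}, v <= \sum_(i in R) (a' i - t))) ->
  forall i, exists i', a i = a' i'.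
Proof.
move=> eq_inf.
pose hinge (b : 'I_n -> int) (t : int) : int := \sum_(i | b i < t) (b i - t).
have hinge_le b t (R : {set 'I_n}) : hinge b t <= \sum_(i in R) (b i - t).
  rewrite /hinge big_mkcond [leRHS]big_mkcond /=; apply: ler_sum => i _.
  by case: (ltP (b i) t); case: (i \in R); lia.
have hingeE b t : hinge b t = \sum_(i in [set i | b i < t]) (b i - t).
  by apply: eq_bigl => i; rewrite inE.
have eq_hinge t : hinge a t = hinge a' t.
  apply/le_anti/andP; split.
    by rewrite [leRHS]hingeE; apply: (eq_inf (hinge a t) t).1 => R.
  by rewrite [leRHS]hingeE; apply: (eq_inf (hinge a' t) t).2 => R.
have hinge_slope b t : hinge b t - hinge b (t + 1) = \sum_i (b i <= t)%R%:R.
  rewrite /hinge [X in X - _]big_mkcond [X in _ - X]big_mkcond /= -sumrB.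
  apply: eq_bigr => i _.
  by case: (ltP (b i) t); case: (ltP (b i) (t + 1)); case: (leP (b i) t); lia.
(* A second difference: the slopes on either side of [t] differ by the number of indices with value
   [t]. *)
have countE b t : \sum_i (b i == t)%:R = hinge b t - hinge b (t + 1)
    - (hinge b (t - 1) - hinge b (t - 1 + 1)).
  rewrite !hinge_slope -sumrB; apply: eq_bigr => i _; lia.
move=> i; suff /existsP[i' /eqP] : [exists i', a i == a' i'] by exists i'.
have : \sum_j (a' j == a i)%:R != 0 :> int.
  rewrite countE -!eq_hinge -countE (bigD1 i) //= eqxx gt_eqF //.
  by rewrite ltr_wpDr // sumr_ge0 // => j _; apply: ler0n.
apply: contraNT => /existsPn no_a'; apply/eqP/big1 => j _.
by rewrite eq_sym (negbTE (no_a' j)).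
Qed.

Lemma eq_of_mul_eq_sub (n c d : nat) (q : int) : (c < n)%N -> (d < n)%N ->
  n%:Z * q = c%:Z - d%:Z -> c = d /\ q = 0.
Proof.
move=> cn dn nq; have q0 : q = 0 by nia.
by split=> //; move: nq; rewrite q0; lia.
Qed.

(** * Iwahori matrices and monomial representatives *)

Section IwahoriWeights.
Variables (k : fieldType) (G : linear_group) (n : nat).

(** Above the diagonal [d > 0] already makes the weight positive. Below it, the factor [leps]
    contributes [n * n], which exceeds [d * (i - j) <= n * (n - 1)]. *)
Lemma iwahori_weighted_unipotent (d : nat) (g : 'M[laurent k]_n) :
  (0 < d <= n)%N -> iwahori G g ->
  weighted_unipotent (n * n)%N (fun i => - (d * i)%N%:Z) g.
Proof.
move=> d_n [_ g_int g_diag g_low]; split=> [i j ij a|i]; last first.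
  exact: order_at_power_series_unit.
have [ji|ji|/val_inj ji] := ltngtP j i; last by rewrite ji eqxx in ij.
  have [g' g'0 ->] := g_low _ _ ji => a_lt; rewrite lcoefM fsbig1 // => b _ /=.
  have [->|_] := eqVneq b 1; last by rewrite mul0r.
  rewrite g'0 ?mulr0 //.
  have := ltn_ord i; nia.
move=> a_lt; apply: g_int; nia.
Qed.

Lemma representative_entries (x : ext_affine_weyl G n) (M : 'M[laurent k]_n) :
  representative x M -> exists s : 'I_n -> bool, forall i j,
    M i j = (-1) ^+ s i * leps ^ (sval x.2 0 i) *+ (x.1 i == j).
Proof.
have entry i j : monomial_mx k x i j = leps ^ (sval x.2 0 i) *+ (x.1 i == j).
  by rewrite /monomial_mx mul_diag_mx !mxE mulr_natr.
rewrite /representative => rep.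
have [->|[i0 ->]] : M = monomial_mx k x \/
    exists i0, M = negate_row i0 (monomial_mx k x).
- by case: G x entry rep => x _ => [[]|->] //; left.
- by exists (fun=> false) => i j; rewrite mul1r entry.
exists (fun i => i == i0) => i j; rewrite mxE entry.
by case: eqP => _; rewrite ?mul1r // expr1 mulN1r mulNrn.
Qed.

End IwahoriWeights.

Theorem theorem1 (F : finFieldType) (kbar : closedFieldType)
    (iota : {rmorphism F -> kbar})
    (kbar_algebraic : forall a : kbar, algebraicOver iota a)
    (G : linear_group) (n : nat) (n_ge2 : (2 <= n)%N)
    (M M' : 'M[laurent kbar]_n)
    (M_in_G : L_points G M) (M'_in_G : L_points G M')
    (eq_val_minors :
      forall (m : nat) (R C : {set 'I_n})
             (cardR : #|R| = m) (cardC : #|C| = m),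
        (1 <= m <= n)%N ->
        lval (minor cardR cardC M) = lval (minor cardR cardC M'))
    (x x' : ext_affine_weyl G n) :
  iwahori_coset x M -> iwahori_coset x' M' -> x = x'.
Proof.
pose N : int := (n * n)%N; have N_gt0 : 0 < N by rewrite /N; nia.
pose lam (i : 'I_n) : int := - (n * i)%N%:Z.
(* [lam] and [mu] are the weights of [iwahori_weighted_unipotent] for [d = n] and [d = 1]. *)
pose mu (j : 'I_n) : int := - (1 * j)%N%:Z.
pose a (y : ext_affine_weyl G n) (i : 'I_n) : int :=
  N * sval y.2 0 i + lam i - mu (y.1 i).
(* The shift [t] gathers the bounds for all sizes [m] into one statement about subsets of any size,
   as [eq_subset_sums_values] requires. *)
have subset_sumsE y (A : 'M[laurent kbar]_n) (v t : int) : iwahori_coset y A ->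
    (forall R : {set 'I_n}, v <= \sum_(i in R) (a y i - t)) <->
    (forall m, minors_ge N m lam mu (v + t * m%:Z) A).
  move=> [g [B [h [g_iw /representative_entries[s BE] h_iw ->]]]].
  have g_uni : weighted_unipotent N lam g.
    by apply: iwahori_weighted_unipotent g_iw; lia.
  have h_uni : weighted_unipotent N mu h.
    by apply: iwahori_weighted_unipotent h_iw; lia.
  have minorsE m u := iff_trans
    (minors_ge_double_coset N_gt0 m u B g_uni h_uni)
    (minors_ge_monomial N_gt0 m lam mu u BE).
  split=> [sum_ge m|min_ge R].
    apply/minorsE => r r_inj; have := sum_ge [set r j | j in 'I_m].
    rewrite big_imset /=; last by move=> ? ? _ _; apply: r_inj.
    rewrite sumrB sumr_const card_ord /a -mulr_natr natz; lra.
  have /minorsE/(_ _ (@enum_val_inj _ (mem R))) := min_ge #|R|.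
  rewrite (_ : \sum_(i in R) _ = \sum_j a y (@enum_val _ (mem R) j) - t * #|R|).
    rewrite /a; lra.
  by rewrite -(big_enum_val (a y)) sumrB sumr_const -mulr_natr natz.
move=> Mx M'x'.
have values i : exists i', a x i = a x' i'.
  apply: eq_subset_sums_values => v t.
  split=> [/(subset_sumsE _ _ _ _ Mx) | /(subset_sumsE _ _ _ _ M'x')] min_ge.
    apply/(subset_sumsE _ _ _ _ M'x') => m.
    by apply: (minors_ge_lval N_gt0 _ (min_ge m)) => *; apply: eq_val_minors.
  apply/(subset_sumsE _ _ _ _ Mx) => m.
  by apply: (minors_ge_lval N_gt0 _ (min_ge m)) => *; apply/esym/eq_val_minors.
(* [lam i - mu j = j - n * i] runs through distinct residues modulo [n * n]. *)
have eq_x i : x.1 i = x'.1 i /\ sval x.2 0 i = sval x'.2 0 i.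
  have [i'] := values i; rewrite /a /lam /mu /N.
  set l := sval x.2 0 i; set l' := sval x'.2 0 i' => eq_a.
  (* Comparing modulo [n] gives the permutation value; dividing the rest by [n] then gives [i] and
     [l]. *)
  have [|/esym /val_inj wi q0] :=
    eq_of_mul_eq_sub (q := n%:Z * (l - l') + i'%:Z - i%:Z)
      (ltn_ord (x'.1 i')) (ltn_ord (x.1 i)); first by lia.
  have [|/val_inj ii' ll'0] := eq_of_mul_eq_sub (q := l - l')
    (ltn_ord i) (ltn_ord i'); first by lia.
  by subst i'; split=> //; apply: subr0_eq.
case: x x' eq_x {Mx M'x' values} => [w [l hl]] [w' [l' hl']] /= eq_x.
have -> : w = w' by apply/permP => i; case: (eq_x i).
have ll' : l = l' by apply/rowP => i; case: (eq_x i).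
by subst l'; rewrite (Prop_irrelevance hl hl').
Qed.
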